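(* Let $\mathcal G$ be an smDG with vertex set $V$, let $X,Y,Z\subseteq V$ be disjoint sets of vertices, and let $S$ be the set of selected vertices of the canonical graph $\mathrm{can}(\mathcal G)$. Then $X\perp_{sm}Y\mid Z$ in $\mathcal G$ if and only if $X\perp_D Y\mid Z,S$ in $\mathrm{can}(\mathcal G)$.
   Context: **smDG.** An independence system over a finite set $V$ is a collection of subsets of $V$ (faces) containing $\emptyset$ and closed under taking subsets; a maximal face is one not strictly contained in another. An smDG is a quadruple $\mathcal G=(V,\mathcal E,\mathcal L,\mathcal S)$ with $(V,\mathcal E)$ a directed graph (cycles and self-loops allowed) and $\mathcal L$ (marginalized), $\mathcal S$ (selected) independence systems over $V$. $\mathrm{pa}_{\mathcal G}(b)=\{a: a\to b\in\mathcal E\}$; descendants are along directed paths of length $\ge 0$ in $(V,\mathcal E)$. **Canonical graph.** $\mathrm{can}(\mathcal G)$ is obtained from $(V,\emptyset)$, with $V$ the visible vertices, by: (1) for each $a\to b\in\mathcal E$ where $a$ is an element of some face of $\mathcal S$ and $b$ is an element of some face of $\mathcal L$, adding a marginalized vertex $m_{ab}$, a selected vertex $s_{ab}$ and a path $a\to s_{ab}\leftarrow m_{ab}\to b$; (2) for each other $a\to b\in\mathcal E$, adding the edge $a\to b$; (3) for each maximal face $V_m\in\mathcal L$, adding a marginalized vertex $m$ and edges from $m$ to every vertex of $V_m$; (4) for each maximal face $V_s\in\mathcal S$, adding a selected vertex $s$ and edges from every vertex of $V_s$ to $s$. **Functionally determined variables.** For a set $Z$ of visible vertices in a graph or smDG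 $\mathcal H$, $\lceil Z\rceil_{\mathcal H}$ is obtained by starting with $Z$ and repeatedly adding every visible vertex $v$ such that $\mathrm{pa}_{\mathcal H}(v)\subseteq\lceil Z\rceil_{\mathcal H}$ (and, in the case of an smDG $(V,\mathcal E,\mathcal L,\mathcal S)$, such that moreover $v\notin\bigcup_{B\in\mathcal L}B$), until convergence. **D-separation.** In $\mathrm{can}(\mathcal G)$, $X\perp_D Y\mid Z,S$ means that $X$ and $Y$ are d-separated (usual path-based criterion) given $\lceil Z\rceil_{\mathrm{can}(\mathcal G)}\cup S$. **sm-separation.** A path in $\mathcal G$ is a sequence $(v_1,t_1,v_2,\ldots,t_{k-1},v_k)$ of distinct vertices and edges where each $v_i\in V$ and each edge type $t_i$ is one of $\leftarrow$, $\to$ (the corresponding directed edge between $v_i$ and $v_{i+1}$ is in $\mathcal E$), $\leftrightarrow$ ($v_i,v_{i+1}$ lie in a common face of $\mathcal L$), or $-$ ($v_i,v_{i+1}$ lie in a common face of $\mathcal S$). In a subsequence $v_i,t_i,v_{i+1},t_{i+1},v_{i+2}$ the vertex $v_{i+1}$ is a collider if both $t_i$ and $t_{i+1}$ have arrowheads at $v_{i+1}$ ($\leftrightarrow$ has arrowheads at both ends, $-$ has none), and a non-collider otherwise. The path is active at $v_i$ given $Z$ if: when $v_i$ is a non-collider, $v_i\notin\lceil Z\rceil_{\mathcal G}$; when $v_i$ is a collider, it has a descendant that is in $Z$ or that is in some face of $\mathcal S$. A path is active if it is active at every vertex in it. $X\not\perp_{sm}Y\mid Z$ means there is a path from some $x\in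 X$ to some $y\in Y$ that is active given $Z$; otherwise $X\perp_{sm}Y\mid Z$. *)

(* Defs.v *)
From HB Require Import structures.
From mathcomp Require Import all_boot.

Set Implicit Arguments.
Unset Strict Implicit.
Unset Printing Implicit Defensive.

Definition independence_system (V : finType) (F : {set {set V}}) : Prop :=
  set0 \in F /\ (forall A B : {set V}, A \in F -> B \subset A -> B \in F).

Record smDG (V : finType) := SmDG {
  edge : rel V;
  marginalized : {set {set V}};
  selected : {set {set V}};
  marginalized_indep : independence_system marginalized;
  selected_indep : independence_system selected
}.

Definition maximal_face (V : finType) (F : {set {set V}}) (A : {set V}) : bool :=
  maxset (fun B => B \in F) A.

(* The closure of Z in the directed graph e, where only the vertices satisfying
   [eligible] may be added. The iteration increases W, hence is stationary after
   at most #|T| rounds. *)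
Definition fdet_step (T : finType) (e : rel T) (eligible : pred T)
    (W : {set T}) : {set T} :=
  W :|: [set v | eligible v & [forall u, e u v ==> (u \in W)]].

Definition fdet (T : finType) (e : rel T) (eligible : pred T)
    (Z : {set T}) : {set T} :=
  iter #|T| (fdet_step e eligible) Z.

(* [Fwd] is ->, [Bwd] is <-, [Bidir] is <-> and [Undir] is -- . *)
Inductive edge_type := Fwd | Bwd | Bidir | Undir.

Definition head_at_left (t : edge_type) : bool :=
  match t with Bwd | Bidir => true | Fwd | Undir => false end.

Definition head_at_right (t : edge_type) : bool :=
  match t with Fwd | Bidir => true | Bwd | Undir => false end.

(* The path (v_1, t_1, v_2, ..., t_{k-1}, v_k) is given by its first vertex
   x = v_1 and the sequence p = [:: (t_1, v_2); ...; (t_{k-1}, v_k)]; below,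
   positions are counted from 0. *)
Section Paths.
Variables (T : finType) (link : edge_type -> rel T).
Implicit Types (x : T) (p : seq (edge_type * T)).

Fixpoint linked x p : bool :=
  if p is (t, y) :: p' then link t x y && linked y p' else true.

Definition path_vertices x p : seq T := x :: unzip2 p.

Definition is_path x p : bool := linked x p && uniq (path_vertices x p).

Definition collider p (i : nat) : bool :=
  [&& 0 < i, i < size p,
      head_at_right (nth Fwd (unzip1 p) i.-1) &
      head_at_left (nth Fwd (unzip1 p) i)].

(* C is the set that non-colliders have to avoid, O the set that colliders have
   to belong to. Every vertex of the path is tested, and the two endpoints, which
   are not colliders, are non-colliders: they too have to avoid C. This matters
   because C may contain functionally determined vertices of X and Y. *)
Definition active (C O : {set T}) x p : Prop :=
  forall i, i <= size p ->
    let v := nth x (path_vertices x p) i in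
    if collider p i then v \in O else v \notin C.

Definition active_path_between (C O X Y : {set T}) : Prop :=
  exists x p, [/\ x \in X, last x (unzip2 p) \in Y, is_path x p & active C O x p].

End Paths.

Definition digraph_link (T : finType) (e : rel T) (t : edge_type) : rel T :=
  fun u v =>
    match t with
    | Fwd => e u v
    | Bwd => e v u
    | Bidir | Undir => false
    end.

Definition d_separated (T : finType) (e : rel T) (X Y C : {set T}) : Prop :=
  ~ active_path_between (digraph_link e) C
      [set v | [exists d in C, connect e v d]] X Y.

Section SmSeparation.
Variables (V : finType) (G : smDG V).

Definition sm_link (t : edge_type) : rel V :=
  fun u v =>
    match t with
    | Fwd => edge G u v
    | Bwd => edge G v u
    | Bidir => [exists F in marginalized G, (u \in F) && (v \in F)]
    | Undir => [exists F in selected G, (u \in F) && (v \in F)]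
    end.

Definition sm_fdet (Z : {set V}) : {set V} :=
  fdet (edge G) (fun v => v \notin cover (marginalized G)) Z.

Definition sm_separated (X Y Z : {set V}) : Prop :=
  ~ active_path_between sm_link (sm_fdet Z)
      [set v | [exists d in Z :|: cover (selected G), connect (edge G) v d]] X Y.

End SmSeparation.

Section CanonicalGraph.
Variables (V : finType) (G : smDG V).

Definition replaced_edge (ab : V * V) : bool :=
  [&& edge G ab.1 ab.2, ab.1 \in cover (selected G)
    & ab.2 \in cover (marginalized G)].

Inductive can_vertex :=
  | Visible of V
  | EdgeMarg of {ab : V * V | replaced_edge ab}
  | EdgeSel of {ab : V * V | replaced_edge ab}
  | FaceMarg of {A : {set V} | maximal_face (marginalized G) A}
  | FaceSel of {A : {set V} | maximal_face (selected G) A}.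

Definition can_vertex_to_sum (u : can_vertex) :=
  match u return
    V + ({ab : V * V | replaced_edge ab} + ({ab : V * V | replaced_edge ab} +
    ({A : {set V} | maximal_face (marginalized G) A} +
     {A : {set V} | maximal_face (selected G) A})))
  with
  | Visible v => inl v
  | EdgeMarg e => inr (inl e)
  | EdgeSel e => inr (inr (inl e))
  | FaceMarg A => inr (inr (inr (inl A)))
  | FaceSel A => inr (inr (inr (inr A)))
  end.

Definition can_vertex_of_sum s : can_vertex :=
  match s with
  | inl v => Visible v
  | inr (inl e) => EdgeMarg e
  | inr (inr (inl e)) => EdgeSel e
  | inr (inr (inr (inl A))) => FaceMarg A
  | inr (inr (inr (inr A))) => FaceSel A
  end.

Lemma can_vertex_to_sumK : cancel can_vertex_to_sum can_vertex_of_sum.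
Proof. by case. Qed.

HB.instance Definition _ :=
  Finite.copy can_vertex (can_type can_vertex_to_sumK).

Definition can_edge : rel can_vertex :=
  fun u w =>
    match u, w with
    | Visible a, Visible b => edge G a b && ~~ replaced_edge (a, b)
    | Visible a, EdgeSel e => a == (val e).1
    | EdgeMarg e, EdgeSel f => e == f
    | EdgeMarg e, Visible b => b == (val e).2
    | FaceMarg A, Visible b => b \in val A
    | Visible a, FaceSel A => a \in val A
    | _, _ => false
    end.

Definition is_visible (u : can_vertex) : bool :=
  if u is Visible _ then true else false.

Definition can_selected : {set can_vertex} :=
  [set u | match u with EdgeSel _ | FaceSel _ => true | _ => false end].

Definition can_fdet (Z : {set can_vertex}) : {set can_vertex} :=
  fdet can_edge is_visible Z.

Definition D_separated (X Y Z : {set V}) (S : {set can_vertex}) : Prop :=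
  d_separated can_edge (Visible @: X) (Visible @: Y)
    (can_fdet (Visible @: Z) :|: S).

End CanonicalGraph.

(* Main.v *)
Require Import Defs.
From mathcomp Require Import all_boot.

Set Implicit Arguments.
Unset Strict Implicit.
Unset Printing Implicit Defensive.

(** The idea is that the canonical graph subdivides the edges of the smDG:
    [a <-> b] becomes [a <- m -> b], [a -- b] becomes [a -> s <- b], and a
    replaced edge [a -> b] becomes [a -> s <- m -> b]. Each subdivision keeps the
    arrowheads at its two visible ends. Its hidden inner vertices never block:
    an [s] is a conditioned collider, an [m] is an unconditioned non-collider.
    So paths correspond, as soon as the two tests on visible vertices agree.

    The tests for non-colliders agree because a visible vertex in a face of [L]
    has a marginalized parent, hence is never added to the closure of [Z] in the
    canonical graph: both closures of [Z] are equal ([can_fdetE]).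

    The tests for colliders agree up to one point. A replaced edge cannot be
    followed by a directed path in the canonical graph, but it starts at an
    ancestor of a selected vertex, so a visible vertex is an ancestor of the
    conditioning set if and only if it has a descendant in the closure of [Z] or
    in a face of [S] ([can_ancestors_Visible]). The sm-criterion asks for a
    descendant in [Z] itself or in a face of [S]. If a collider satisfies only the
    first condition, then it is itself functionally determined
    ([determined_ancestor]), so its predecessor on the path is a determined
    parent. That predecessor is a non-collider and blocks the path. Thus both
    criteria leave the same paths active ([sm_active_fdet]).

    From the canonical graph to the smDG ([contract]) the subdivisions are undone,
    and the path has no repeated hidden vertex, so no other segment can
    occur. In the other direction ([expand]) one maximal face may serve several
    edges of the path, and its hidden vertex would be repeated. Going from the
    new visible vertex to that hidden vertex, and then on along the rest of the
    path, removes the repetition ([reroute]). *)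

(** * Activity along a path, edge by edge *)

Section ActiveFrom.
Variables (T : finType) (link : edge_type -> rel T) (C O : {set T}).
Implicit Types (h col : bool) (x y w : T) (p q r : seq (edge_type * T)).

Definition vertex_ok col x := if col then x \in O else x \notin C.

(** Here [h] says whether the edge that leads into [x] has its head at [x]; it is
    [false] at the start of a path. Unlike [active], this form lets a path be
    extended or cut at its left end. *)
Fixpoint active_from h x p : bool :=
  if p is (t, y) :: p' then
    vertex_ok (h && head_at_left t) x && active_from (head_at_right t) y p'
  else vertex_ok false x.

Lemma active_fromP h x p :
  (forall i, i <= size p ->
     vertex_ok (if i is 0 then [&& h, 0 < size p & head_at_left (nth Fwd (unzip1 p) 0)]
                else collider p i) (nth x (path_vertices x p) i))
  <-> active_from h x p.
Proof.
elim: p h x => [|[t y] p IHp] h x /=.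
  split=> [/(_ 0 isT)|ok [|i] //=]; first by rewrite andbF.
  by rewrite andbF.
split=> [ok|/andP[okx /IHp oky] [|i] //=].
  apply/andP; split; first exact: ok 0 isT.
  apply/IHp => i le_ip; move: (ok i.+1 le_ip) => /=.
  rewrite (set_nth_default y); last by rewrite /= size_map.
  by case: i le_ip => [|i] le_ip; rewrite /collider /= ?ltnS // andbCA.
rewrite ltnS => le_ip; move: (oky i le_ip).
rewrite (set_nth_default x); last by rewrite /= size_map.
by case: i le_ip => [|i] le_ip; rewrite /collider /= ?ltnS // andbCA.
Qed.

Lemma activeP x p : active C O x p <-> active_from false x p.
Proof.
apply: iff_trans (active_fromP false x p); rewrite /active /vertex_ok.
by split=> ok i le_ip; have := ok i le_ip; case: i le_ip.
Qed.

(** To be used with the hidden vertex of a face as [w]. Every edge at [w] leaves it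
    with the same type [d], so [w] has the same collider status wherever it occurs. Hence, if [w] already
    lies on the path from [y], the part from [y] to [w] can be dropped. *)
Lemma reroute w d h y q :
    (forall t u, link t w u -> t = d) -> link d w y ->
    vertex_ok (h && head_at_left d) w ->
    linked link y q -> uniq (path_vertices y q) ->
    active_from (head_at_right d) y q -> w != last y (unzip2 q) ->
  exists r, [/\ linked link w r, uniq (path_vertices w r),
    last w (unzip2 r) = last y (unzip2 q), active_from h w r
    & {subset unzip2 r <= path_vertices y q}].
Proof.
move=> only_d dwy okw.
have [w_q|w_q] := boolP (w \in path_vertices y q); last first.
  move=> lq uq aq _; exists ((d, y) :: q).
  by split=> //; rewrite /= ?dwy ?okw // -/(path_vertices y q) w_q.
move: (head_at_right d) => h0; rewrite {dwy}.
elim: q y h0 w_q => [|[t z] q IHq] y h0; rewrite /path_vertices /=.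
  by rewrite inE => /eqP->; rewrite eqxx.
rewrite inE; case: eqP => [<- _|_ /= w_q].
  move=> /andP[lwz lq] uq /andP[_ aq] _.
  exists ((t, z) :: q); split=> //=; first by rewrite lwz.
    by rewrite (only_d _ _ lwz) okw -(only_d _ _ lwz).
  by move=> v vq; rewrite inE vq orbT.
move=> /andP[_ lq] /andP[_ uq] /andP[_ aq] neq_w.
have [r [lr ur er ar sr]] := IHq z _ w_q lq uq aq neq_w.
by exists r; split=> // v /sr vq; rewrite inE vq orbT.
Qed.

End ActiveFrom.

Arguments vertex_ok : simpl never.

(** * Functionally determined vertices *)

Section Fdet.
Variables (T : finType) (e : rel T) (eligible : pred T).
Implicit Types (Z W : {set T}).

(** The only reason for a vertex outside [Z] to be in the closure is the
    determination rule. *)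
Lemma fdet_elim Z v :
  v \in fdet e eligible Z -> v \notin Z ->
  eligible v /\ forall u, e u v -> u \in fdet e eligible Z.
Proof.
rewrite /fdet; elim: #|T| => [|n IHn] /=; first by move->.
rewrite {1}/fdet_step !inE => /orP[v_n v_Z|/andP[elv /forallP par_v] _].
  have [elv par_v] := IHn v_n v_Z.
  by split=> // u /par_v u_n; rewrite inE u_n.
by split=> // u euv; have := implyP (par_v u) euv; rewrite inE => ->.
Qed.

(** The closures in the smDG and in its canonical graph are iterated different
    numbers of times, since the canonical graph has more vertices. This makes them
    comparable: as long as the iteration is not stationary, the set gains an
    element in each round. *)
Lemma fdet_stationary Z n :
  #|T| <= n -> iter n (fdet_step e eligible) Z = fdet e eligible Z.
Proof.
set f := fdet_step _ _ => le_Tn.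
have fix_or_grow m : f (iter m f Z) = iter m f Z \/ m < #|f (iter m f Z)|.
  elim: m => [|m [fixm|ltm]] /=; last 1 first.
  - have [->|neq] := eqVneq (f (f (iter m f Z))) (f (iter m f Z)); first by left.
    right; apply: leq_ltn_trans ltm _; apply: proper_card.
    by rewrite properEneq eq_sym neq subsetUl.
  - have [->|neq] := eqVneq (f Z) Z; first by left.
    right; apply: leq_ltn_trans (leq0n #|Z|) _; apply: proper_card.
    by rewrite properEneq eq_sym neq subsetUl.
  - by left; rewrite !fixm.
have fixT : f (fdet e eligible Z) = fdet e eligible Z.
  have [//|] := fix_or_grow #|T|.
  by rewrite ltnNge max_card.
rewrite -(subnK le_Tn) iterD -/f; elim: (n - _) => //= m IHm.
by rewrite IHm fixT.
Qed.

End Fdet.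

(** * The canonical graph *)

Section Canonical.
Variables (V : finType) (G : smDG V).
Implicit Types (h : bool) (x y v : V) (Z : {set V}).

Let vis : V -> can_vertex G := @Visible V G.

Lemma Visible_inj : injective vis.
Proof. by move=> x y []. Qed.

Lemma in_Visible x (A : {set V}) : (vis x \in vis @: A) = (x \in A).
Proof. exact: mem_imset Visible_inj. Qed.

Lemma notin_Visible w (A : {set V}) : ~~ is_visible w -> (w \in vis @: A) = false.
Proof. by move=> hidden; apply/imsetP => -[v _ def_w]; rewrite def_w in hidden. Qed.

Lemma maximal_face_above (F : {set {set V}}) A :
  A \in F -> exists2 B, maximal_face F B & A \subset B.
Proof.
move=> FA.
by have [B maxB sAB] := @maxset_exists V (fun B => B \in F) A FA; exists B.
Qed.

Lemma maximal_face_in (F : {set {set V}}) A : maximal_face F A -> A \in F.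
Proof. by move/maxsetp. Qed.

Lemma mem_cover (F : {set {set V}}) A x : A \in F -> x \in A -> x \in cover F.
Proof. by move=> FA xA; apply/bigcupP; exists A. Qed.

(** A vertex in a face of [L] has a hidden parent in the canonical graph, which is
    never in the closure; the edges into any other vertex are not replaced. *)
Lemma can_fdet_step Z :
  fdet_step (@can_edge V G) (@is_visible V G) (vis @: Z) =
  vis @: fdet_step (edge G) (fun v => v \notin cover (marginalized G)) Z.
Proof.
apply/setP=> w; rewrite !inE.
case: w => [v|e|e|A|A] /=; last first.
1-4: by rewrite !notin_Visible.
rewrite in_Visible -/(vis v) in_Visible !inE; congr (_ || _).
apply/forallP/andP => [par_v|[vL /forallP par_v] [u|e|e|A|A]] //=.
- have vL : v \notin cover (marginalized G).
    apply/negP => /bigcupP[A FA vA].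
    have [B maxB sAB] := maximal_face_above FA.
    have := par_v (FaceMarg (exist _ B maxB)) => /=.
    by rewrite (subsetP sAB) //= => /imsetP[].
  split=> //; apply/forallP=> u; apply/implyP=> euv.
  have := par_v (vis u).
  by rewrite in_Visible /= /replaced_edge /= euv (negPf vL) andbF.
- rewrite -/(vis u) in_Visible; apply/implyP => /andP[euv _].
  exact: (implyP (par_v u)).
- apply/implyP => /eqP ve; move: vL; rewrite ve.
  by case/and3P: (valP e) => _ _ ->.
- by apply/implyP => vA; rewrite (mem_cover (maximal_face_in (valP A)) vA) in vL.
Qed.

Lemma can_fdetE Z : can_fdet (vis @: Z) = vis @: sm_fdet G Z.
Proof.
rewrite /sm_fdet -(@fdet_stationary _ _ _ _ #|{: can_vertex G}|); last first.
  exact: leq_card Visible_inj.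
rewrite /can_fdet /fdet; elim: #|_| => //= n ->.
exact: can_fdet_step.
Qed.

(** * Ancestors of the conditioning set *)

Definition sm_ancestors (D : {set V}) :=
  [set v | [exists d in D :|: cover (selected G), connect (edge G) v d]].

Definition can_ancestors (D : {set can_vertex G}) :=
  [set v | [exists d in D, connect (@can_edge V G) v d]].

(** A directed path of the smDG may use a replaced edge [v -> u], which is not part
    of a directed path in the canonical graph; but then [v] is a parent of a
    selected vertex. *)
Lemma can_ancestors_Visible (C : {set V}) v :
  (vis v \in can_ancestors (vis @: C :|: can_selected G)) = (v \in sm_ancestors C).
Proof.
rewrite !inE; apply/existsP/existsP => -[d /andP[d_in /connectP[p]]].
  elim: p v => [|u p IHp] v /=.
    move=> _ def_d; exists v; rewrite connect0 andbT.
    by move: d_in; rewrite def_d !inE in_Visible /= orbF => ->.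
  case/andP; case: u => [u|e|e|A|A] //=.
  - case/andP=> evu _ pth /(IHp u pth)[d' /andP[d'_in ud']].
    by exists d'; rewrite d'_in (connect_trans (connect1 evu)).
  - move=> /eqP def_v _ _; exists v; rewrite connect0 andbT inE def_v.
    by case/and3P: (valP e) => _ -> _; rewrite orbT.
  - move=> vA _ _; exists v; rewrite connect0 andbT inE.
    by rewrite (mem_cover (maximal_face_in (valP A)) vA) orbT.
have to_sel u s : s \in can_selected G -> can_edge (vis u) s ->
    exists d', (d' \in vis @: C :|: can_selected G) &&
               connect (@can_edge V G) (vis u) d'.
  by move=> sS us; exists s; rewrite (connect1 us) inE sS orbT.
elim: p v => [|u p IHp] v /=.
  move=> _ def_d; move: d_in; rewrite def_d inE => /orP[vC|/bigcupP[A FA vA]].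
    by exists (vis v); rewrite connect0 inE in_Visible vC.
  have [B maxB sAB] := maximal_face_above FA.
  by apply: (to_sel _ (FaceSel (exist _ B maxB))); rewrite ?inE //= (subsetP sAB).
case/andP=> evu pth /(IHp u pth)[d' /andP[d'_in ud']].
have [rvu|nrvu] := boolP (replaced_edge G (v, u)).
  by apply: (to_sel _ (EdgeSel (exist _ (v, u) rvu))); rewrite ?inE /=.
exists d'; rewrite d'_in (connect_trans _ ud') //.
by rewrite connect1 //= evu nrvu.
Qed.

(** Determination propagates against the edges: a determined vertex outside [Z]
    has determined parents only, so it spreads along a directed path from its end
    back to [v], as long as the path does not meet [Z]. *)
Lemma determined_ancestor Z v :
  v \in sm_ancestors (sm_fdet G Z) -> v \notin sm_ancestors Z ->
  [/\ v \in sm_fdet G Z & v \notin Z].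
Proof.
rewrite !inE => /existsP[d /andP[d_in /connectP[p]]].
elim: p v => [|u p IHp] v /=.
  move=> _ def_d /existsP noZ; move: d_in; rewrite def_d inE.
  have: v \notin Z :|: cover (selected G).
    by apply/negP=> v_in; case: noZ; exists v; rewrite v_in connect0.
  by rewrite inE negb_or => /andP[-> /negPf->]; rewrite orbF.
case/andP=> evu pth def_d /existsP noZ.
have [|u_det uZ] := IHp u pth def_d.
  apply/existsP=> -[d' /andP[d'_in ud']]; case: noZ; exists d'.
  by rewrite d'_in (connect_trans (connect1 evu)).
have [_ par_u] := fdet_elim u_det uZ; split; first exact: par_u.
apply/negP=> vZ; case: noZ; exists v.
by rewrite connect0 inE vZ.
Qed.

(** The hypothesis on [h] records why [x] can be entered by an arrowhead: through a
    bidirected edge, or from a vertex that is a non-collider and so is not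
    determined. Either fact excludes that [x] is determined without being in [Z],
    which is the only case in which the two tests differ. *)
Lemma sm_active_fdet Z h x p :
    (h = true -> x \in cover (marginalized G) \/
          exists2 a, edge G a x & a \notin sm_fdet G Z) ->
    linked (sm_link G) x p ->
  active_from (sm_fdet G Z) (sm_ancestors (sm_fdet G Z)) h x p =
  active_from (sm_fdet G Z) (sm_ancestors Z) h x p.
Proof.
elim: p h x => //= -[t y] p IHp h x into_x /andP[txy lp].
have ->: vertex_ok (sm_fdet G Z) (sm_ancestors (sm_fdet G Z)) (h && head_at_left t) x
       = vertex_ok (sm_fdet G Z) (sm_ancestors Z) (h && head_at_left t) x.
  rewrite /vertex_ok; case: ifP => // /andP[hT _].
  apply/idP/idP => [xO|]; last first.
    rewrite !inE => /existsP[d /andP[d_in xd]]; apply/existsP; exists d.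
    rewrite xd andbT; move: d_in; rewrite !inE => /orP[dZ|->]; last by rewrite orbT.
    rewrite /sm_fdet /fdet; elim: #|V| => /= [|n]; rewrite ?dZ //.
    by rewrite !inE => /orP[] ->; rewrite ?orbT.
  apply: contraT => xO'; have [x_det xZ] := determined_ancestor xO xO'.
  have [xL par_x] := fdet_elim x_det xZ.
  have [x_L|[a eax a_det]] := into_x hT; first by rewrite x_L in xL.
  by rewrite par_x in a_det.
case okx: vertex_ok => //=; apply: IHp => //.
case: t txy okx => //= [exy|/existsP[F /and3P[LF _ yF]] _] okx.
  by right; exists x => //; move: okx; rewrite andbF.
by left; apply: mem_cover LF yF.
Qed.

(** * Correspondence of the paths *)

Let can_link := digraph_link (@can_edge V G).

Section Transfer.
Variable C : {set V}.
Let O := sm_ancestors C.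
Let C' := vis @: C :|: can_selected G.
Let O' := can_ancestors C'.

Lemma vertex_ok_Visible col v : vertex_ok C' O' col (vis v) = vertex_ok C O col v.
Proof.
rewrite /vertex_ok; case: col; first by rewrite can_ancestors_Visible.
by rewrite in_setU in_Visible inE orbF.
Qed.

Lemma vertex_ok_selected col s : s \in can_selected G -> vertex_ok C' O' col s = col.
Proof.
move=> sS; have sC : s \in C' by rewrite inE sS orbT.
rewrite /vertex_ok sC; case: col => //.
by rewrite inE; apply/existsP; exists s; rewrite sC connect0.
Qed.

Lemma vertex_ok_marginalized w :
  ~~ is_visible w -> w \notin can_selected G -> vertex_ok C' O' false w.
Proof. by move=> hidden wS; rewrite /vertex_ok inE notin_Visible. Qed.

(** The hidden vertices between two consecutive visible ones form the subdivision
    of exactly one edge: after [a -> s_ab], a path that does not return to [a] must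
    go on with [s_ab <- m_ab -> b]. *)
Lemma contract h x y q :
    linked can_link (vis x) q -> uniq (path_vertices (vis x) q) ->
    last (vis x) (unzip2 q) = vis y -> active_from C' O' h (vis x) q ->
  exists p, [/\ linked (sm_link G) x p, last x (unzip2 p) = y,
    active_from C O h x p & subseq (map vis (unzip2 p)) (unzip2 q)].
Proof.
have [n] := ubnP (size q); elim: n q h x => // n IHn [|[t u] q] h x.
  move=> _ _ _ [->] ok; exists [::]; split=> //=.
  by rewrite -vertex_ok_Visible.
rewrite /= ltnS => lt_qn.
have step t' v s q' : size q' <= size q -> sm_link G t' x v ->
    vertex_ok C' O' (h && head_at_left t') (vis x) ->
    linked can_link (vis v) q' -> uniq (path_vertices (vis v) q') ->
    last (vis v) (unzip2 q') = vis y ->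
    active_from C' O' (head_at_right t') (vis v) q' ->
  exists p, [/\ linked (sm_link G) x p, last x (unzip2 p) = y,
    active_from C O h x p & subseq (map vis (unzip2 p)) (s ++ vis v :: unzip2 q')].
  move=> le_q'q xv okx lq' uq' eq' aq'.
  have [p [lp ep ap sp]] := IHn q' _ v (leq_ltn_trans le_q'q lt_qn) lq' uq' eq' aq'.
  exists ((t', v) :: p); split=> //=; first by rewrite xv.
    by rewrite -vertex_ok_Visible okx.
  by apply: subseq_trans (suffix_subseq _ _); rewrite /= eqxx.
case: u => [v|e|e|A|A] /=.
(* Cases on the vertex that follows [x]. *)
- case/andP=> xv lq /andP[_ uq] eq /andP[okx aq].
  apply: (step t v [::]) => //.
  by case: t xv {okx aq} => //= /andP[].
- case: t => //= /andP[/eqP def_x].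
  case: q step {lt_qn} => [|[[] [v|f|f|A|A]] q] //= step; rewrite ?andbF //.
    case/andP=> /eqP def_v _; rewrite -[Visible _ v]/(vis v) def_v -def_x.
    by rewrite !inE eqxx !orbT.
  case: q step => [|[[] [v|g|g|A|A]] q] //= step; rewrite ?andbF //.
    case/and3P=> /eqP def_f /eqP def_v lq /and4P[_ _ _ uq] eq /and4P[okx _ _ aq].
    apply: (step Bwd v [:: EdgeMarg e; EdgeSel f]) => //=.
      by apply: leq_trans (leqnSn _) (leqnSn _).
    by rewrite def_v def_x def_f; case/and3P: (valP f).
  case/and3P=> /eqP-> /eqP-> _.
  by rewrite !inE eqxx !orbT !andbF.
- case: t => //= /andP[/eqP def_x].
  case: q step {lt_qn} => [|[[] [v|f|f|A|A]] q] //= step; rewrite ?andbF //.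
    case/andP=> /eqP def_v _; rewrite -[Visible _ v]/(vis v) def_v -def_x.
    by rewrite !inE eqxx !orbT.
  case: q step => [|[[] [v|g|g|A|A]] q] //= step; rewrite ?andbF //.
    case/and3P=> /eqP def_f /eqP def_v lq /and4P[_ _ _ uq] eq /and4P[okx _ _ aq].
    apply: (step Fwd v [:: EdgeSel e; EdgeMarg f]); rewrite //= ?andbF //.
      by apply: leq_trans (leqnSn _) (leqnSn _).
    by rewrite def_v def_x def_f; case/and3P: (valP e).
  case/and3P=> /eqP-> /eqP-> _.
  by rewrite !inE eqxx !orbT !andbF.
- case: t => //= /andP[xA].
  case: q step {lt_qn} => [|[[] [v|f|f|B|B]] q] //= step.
  case/andP=> vA lq /and3P[_ _ uq] eq /and3P[okx _ aq].
  apply: (step Bidir v [:: FaceMarg A]) => //=.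
  by apply/existsP; exists (val A); rewrite xA vA (maximal_face_in (valP A)).
- case: t => //= /andP[xA].
  case: q step {lt_qn} => [|[[] [v|f|f|B|B]] q] //= step.
  case/andP=> vA lq /and3P[_ _ uq] eq /and3P[okx _ aq].
  apply: (step Undir v [:: FaceSel A]) => //=.
  by apply/existsP; exists (val A); rewrite xA vA (maximal_face_in (valP A)).
Qed.

(** In a path that expands a path through [s], the two vertices of a replaced edge
    occur only if both ends of the edge are in [s]. This is what makes them new
    when an edge at a new vertex is expanded. Vertices of faces have no
    such restriction, since [reroute] deals with their repetition. *)
Definition carried (s : seq V) (w : can_vertex G) :=
  match w with
  | Visible v => v \in s
  | EdgeMarg e | EdgeSel e => ((val e).1 \in s) && ((val e).2 \in s)
  | FaceMarg _ | FaceSel _ => true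
  end.

(** By induction, the subdivision of the first edge is put in front of the
    expansion of the rest. *)
Lemma expand h x p :
    linked (sm_link G) x p -> uniq (path_vertices x p) -> active_from C O h x p ->
  exists q, [/\ linked can_link (vis x) q, uniq (path_vertices (vis x) q),
    last (vis x) (unzip2 q) = vis (last x (unzip2 p)),
    active_from C' O' h (vis x) q
    & {in path_vertices (vis x) q, forall w, carried (path_vertices x p) w}].
Proof.
elim: p h x => [|[t y] p IHp] h x.
  move=> _ _ okx; exists [::]; split=> //=; first by rewrite vertex_ok_Visible.
  by move=> w; rewrite inE => /eqP->; rewrite /= inE.
move=> /= /andP[xy lp] /andP[xNp up] /andP[okx ap].
have [q [lq uq eq aq cq]] := IHp _ y lp up ap.
rewrite -vertex_ok_Visible in okx.
have xNq : vis x \notin path_vertices (vis y) q.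
  by apply: contra xNp => /cq.
have cxq w : w \in path_vertices (vis y) q -> carried (x :: path_vertices y p) w.
  move/cq; case: w => [v|e|e|A|A] //=; rewrite !inE; first by move->; rewrite orbT.
    by case/andP=> -> ->; rewrite !orbT.
  by case/andP=> -> ->; rewrite !orbT.
have xin : carried (x :: path_vertices y p) (vis x) by rewrite /= inE eqxx.
have edgeNq e : ((val e).1 == x) || ((val e).2 == x) ->
    (EdgeMarg e \notin path_vertices (vis y) q) &&
    (EdgeSel e \notin path_vertices (vis y) q).
  move=> ex; apply/andP; split; apply: contra xNp => /cq /andP[].
    by case/orP: ex => /eqP->.
  by case/orP: ex => /eqP->.
(* [x] and [y] are joined through the vertex [w] of a face. *)
have via_face w d t' : linked can_link (vis x) [:: (t', w)] ->
    (forall t u, can_link t w u -> t = d) -> can_link d w (vis y) ->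
    ~~ is_visible w -> carried (x :: path_vertices y p) w ->
    vertex_ok C' O' (head_at_right t' && head_at_left d) w ->
    head_at_left t = head_at_left t' -> head_at_right t = head_at_right d ->
  exists q', [/\ linked can_link (vis x) q', uniq (path_vertices (vis x) q'),
    last (vis x) (unzip2 q') = vis (last y (unzip2 p)),
    active_from C' O' h (vis x) q'
    & {in path_vertices (vis x) q', forall w, carried (x :: path_vertices y p) w}].
  move=> xw only_d wy hidden cw okw eq_l eq_r; rewrite eq_r in aq.
  have neq_last : w != last (vis y) (unzip2 q).
    by rewrite eq; apply: contra hidden => /eqP->.
  have [r [lr ur er ar sr]] := reroute only_d wy okw lq uq aq neq_last.
  exists ((t', w) :: r); split=> /=.
  - by move: xw; rewrite /= andbT => ->.
  - move: ur => /= ->; rewrite andbT inE negb_or; apply/andP; split.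
      by apply: contra hidden => /eqP<-.
    by apply: contra xNq => /sr.
  - by rewrite er.
  - by rewrite -eq_l okx.
  - by move=> u; rewrite !inE => /or3P[/eqP->|/eqP->|/sr/cxq].
case: t xy okx ap aq via_face {IHp} =>
  [exy|eyx|/existsP[F /and3P[LF xF yF]]|/existsP[F /and3P[SF xF yF]]]
  okx ap aq via_face.
- have [r_xy|nr_xy] := boolP (replaced_edge G (x, y)); last first.
    exists ((Fwd, vis y) :: q); split=> //=.
    + by move: exy => /= ->; rewrite nr_xy.
    + by rewrite xNq.
    + by rewrite okx.
    + by move=> w; rewrite inE => /orP[/eqP->|/cxq].
  pose e : {ab | replaced_edge G ab} := exist _ (x, y) r_xy.
  have /andP[mNq sNq] := edgeNq e (introT orP (or_introl (eqxx x))).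
  exists ((Fwd, EdgeSel e) :: (Bwd, EdgeMarg e) :: (Fwd, vis y) :: q); split=> //=.
  + by rewrite !eqxx.
  + rewrite !in_cons /= xNq sNq mNq /=.
    by move: uq => /= ->.
  + by rewrite okx /= vertex_ok_marginalized ?vertex_ok_selected ?inE.
  + have ce : carried (x :: path_vertices y p) (EdgeSel e) by rewrite /= !inE !eqxx orbT.
    move=> w; rewrite inE => /orP[/eqP->//|]; rewrite inE => /orP[/eqP->//|].
    by rewrite inE => /orP[/eqP->//|/cxq].
- have [r_yx|nr_yx] := boolP (replaced_edge G (y, x)); last first.
    exists ((Bwd, vis y) :: q); split=> //=.
    + by move: eyx => /= ->; rewrite nr_yx.
    + by rewrite xNq.
    + by rewrite okx.
    + by move=> w; rewrite inE => /orP[/eqP->|/cxq].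
  pose e : {ab | replaced_edge G ab} := exist _ (y, x) r_yx.
  have /andP[mNq sNq] := edgeNq e (introT orP (or_intror (eqxx x))).
  exists ((Bwd, EdgeMarg e) :: (Fwd, EdgeSel e) :: (Bwd, vis y) :: q); split=> //=.
  + by rewrite !eqxx.
  + rewrite !in_cons /= xNq sNq mNq /=.
    by move: uq => /= ->.
  + by rewrite okx /= vertex_ok_marginalized ?vertex_ok_selected ?inE.
  + have ce : carried (x :: path_vertices y p) (EdgeSel e) by rewrite /= !inE !eqxx orbT.
    move=> w; rewrite inE => /orP[/eqP->//|]; rewrite inE => /orP[/eqP->//|].
    by rewrite inE => /orP[/eqP->//|/cxq].
- have [B maxB /subsetP sFB] := maximal_face_above LF.
  apply: (via_face (FaceMarg (exist _ B maxB)) Fwd Bwd); rewrite //= ?sFB //.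
    by case=> // -[].
  by rewrite vertex_ok_marginalized ?inE.
- have [B maxB /subsetP sFB] := maximal_face_above SF.
  apply: (via_face (FaceSel (exist _ B maxB)) Bwd Fwd); rewrite //= ?sFB //.
    by case=> // -[].
  by rewrite vertex_ok_selected ?inE.
Qed.

End Transfer.

End Canonical.

Theorem theoremF7 (V : finType) (G : smDG V) (X Y Z : {set V})
    (hXY : [disjoint X & Y]) (hXZ : [disjoint X & Z]) (hYZ : [disjoint Y & Z]) :
  sm_separated G X Y Z <-> D_separated X Y Z (can_selected G).
Proof.
rewrite /D_separated /d_separated can_fdetE /sm_separated.
split=> sep [x [p [xX yY /andP[lp up] /activeP ap]]]; apply: sep.
  case/imsetP: xX lp up yY ap => {}x xX -> lp up /imsetP[y yY ey] ap.
  have [q [lq eq aq sq]] := contract lp up ey ap.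
  exists x, q; split=> //; first by rewrite eq.
    rewrite /is_path lq -(map_inj_uniq (@Visible_inj V G)).
    by apply: subseq_uniq up; rewrite /= eqxx.
  by apply/activeP; move: aq; rewrite sm_active_fdet.
rewrite -[X in active_from _ X]/(sm_ancestors G Z) -sm_active_fdet // in ap.
have [q [lq uq eq aq _]] := expand lp up ap.
exists (Visible G x), q; split.
- by rewrite in_Visible.
- by rewrite eq in_Visible.
- by rewrite /is_path lq.
- exact/activeP.
Qed.
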